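(* Let $q=p^n$ be a power of an odd prime $p$, let $\varepsilon$ be a primitive element of $\mathrm{GF}(q^2)$, and let $\mathcal M_{\alpha,\varepsilon}$ and $\mathcal M_{\alpha',\varepsilon}$ be two BM quasi-Hermitian varieties of $\mathrm{PG}(3,q^2)$. For $x\in\mathrm{GF}(q^2)\setminus\{0\}$ put \[\delta(x):=\frac{(\varepsilon^q-\varepsilon)^2}{4x^{q+1}}.\] Then $\mathcal M_{\alpha,\varepsilon}$ is equivalent to $\mathcal M_{\alpha',\varepsilon}$ if and only if there exists $\sigma\in\mathrm{Aut}(\mathrm{GF}(q^2))$ such that \[\delta(\alpha')=\delta(\alpha)^{\sigma}.\]
   Context: Let $q$ be an odd prime power and let $(J,X,Y,Z)$ be homogeneous coordinates of $\mathrm{PG}(3,q^2)$. Let $\Sigma_\infty$ be the plane $J=0$. For $\alpha\in\mathrm{GF}(q^2)\setminus\{0\}$ and $\beta\in\mathrm{GF}(q^2)\setminus\mathrm{GF}(q)$, let $\mathcal B_{\alpha,\beta}$ be the set of points of $\mathrm{PG}(3,q^2)$ satisfying \[Z^qJ^q-ZJ^{2q-1}+\alpha^q(X^{2q}+Y^{2q})-\alpha(X^2+Y^2)J^{2q-2}=(\beta^q-\beta)(X^{q+1}+Y^{q+1})J^{q-1},\] let $\mathcal F=\{(0,X,Y,Z): X^{q+1}+Y^{q+1}=0\}\subset\Sigma_\infty$, and define \[\mathcal M_{\alpha,\beta}:=(\mathcal B_{\alpha,\beta}\setminus\Sigma_\infty)\cup\mathcal F .\] The set $\mathcal M_{\alpha,\beta}$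 is called a BM quasi-Hermitian variety when $4\alpha^{q+1}+(\beta^q-\beta)^2\neq 0$; so for $\mathcal M_{\alpha,\varepsilon}$ the condition is $\alpha\ne0$ and $4\alpha^{q+1}+(\varepsilon^q-\varepsilon)^2\neq 0$. Two BM quasi-Hermitian varieties $\mathcal M_{\alpha,\beta}$ and $\mathcal M_{\alpha',\beta'}$ are equivalent if there is a semilinear collineation $\psi\in\mathrm{P\Gamma L}(4,q^2)$ with $\psi(\mathcal M_{\alpha,\beta})=\mathcal M_{\alpha',\beta'}$. *)

(* Defs.v *)
From HB Require Import structures.
From mathcomp Require Import all_boot all_order all_fingroup all_algebra all_field.

Set Implicit Arguments.
Unset Strict Implicit.
Unset Printing Implicit Defensive.

Import GRing.Theory VectorInternalTheory.
Local Open Scope ring_scope.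

(* Subspaces of a space over a finite field form a finite type; this is what
   lets sets of points be written as {set _}. *)
HB.instance Definition _ (F : finFieldType) (V : vectType F) :=
  [Countable of {vspace V} by <:].
HB.instance Definition _ (F : finFieldType) (V : vectType F) :=
  [Finite of {vspace V} by <:].

Section ProjectiveSpace.
Variable F : finFieldType.

(* PG(3, F): one-dimensional subspaces of F^4. *)
Record point := Point {
  line_of : {vspace 'rV[F]_4};
  _ : \dim line_of == 1%N
}.

HB.instance Definition _ := [isSub for line_of].
HB.instance Definition _ := [Finite of point by <:].

(* The matrix entries of a coordinate vector v = (J, X, Y, Z) are numbered
   from 0.  All conditions E used below are homogeneous, so it does not matter
   which nonzero representative v of the point P is taken. *)
Definition locus (E : F -> F -> F -> F -> bool) : {set point} :=
  [set P : point | [exists v : 'rV[F]_4,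
     [&& v != 0, v \in line_of P & E (v 0 0) (v 0 1) (v 0 2) (v 0 3)]]].

(* PGammaL(4, F): the maps on points induced by the bijective f : F^4 -> F^4
   that are semilinear for some automorphism sigma of F, that is,
   f (a *: u + v) = sigma a *: f u + f v. *)
Definition PGammaL (psi : {perm point}) : Prop :=
  exists sigma : {rmorphism F -> F}, bijective sigma /\
  exists f : {linear 'rV[F]_4 -> 'rV[F]_4 | sigma \; *:%R}, bijective f /\
  forall (P : point) (v : 'rV[F]_4), v \in line_of P -> f v \in line_of (psi P).

Definition equivalent (M M' : {set point}) : Prop :=
  exists2 psi : {perm point}, PGammaL psi & psi @: M = M'.

Definition Sigma_infty : {set point} := locus (fun J _ _ _ => J == 0).

Variable q : nat.

Definition B_set (alpha beta : F) : {set point} :=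
  locus (fun J X Y Z =>
    Z ^+ q * J ^+ q - Z * J ^+ (2 * q - 1)
      + alpha ^+ q * (X ^+ (2 * q) + Y ^+ (2 * q))
      - alpha * (X ^+ 2 + Y ^+ 2) * J ^+ (2 * q - 2)
    == (beta ^+ q - beta) * (X ^+ q.+1 + Y ^+ q.+1) * J ^+ (q - 1)).

Definition F_set : {set point} :=
  locus (fun J X Y _ => (J == 0) && (X ^+ q.+1 + Y ^+ q.+1 == 0)).

Definition M_set (alpha beta : F) : {set point} :=
  (B_set alpha beta :\: Sigma_infty) :|: F_set.

(* When F = GF(q^2), beta ^+ q != beta says that beta is not in GF(q). *)
Definition is_BM (alpha beta : F) : bool :=
  [&& alpha != 0, beta ^+ q != beta
    & 4%:R * alpha ^+ q.+1 + (beta ^+ q - beta) ^+ 2 != 0].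

Definition delta (eps x : F) : F :=
  (eps ^+ q - eps) ^+ 2 / (4%:R * x ^+ q.+1).

End ProjectiveSpace.

(* Main.v *)
(* Put N x = x^(q+1), T w = w^q - w and e = beta^q - beta. In the chart J = 1 the
   variety is T Z + T (alpha (X^2 + Y^2)) = e (N X + N Y).
   A collineation between two such varieties fixes the plane J = 0: a line of
   the variety through an affine point has a direction (u, v, w) with
   u^2 + v^2 = N u + N v = 0, so at most two lines pass through an affine point,
   while the points of the variety on three of its lines, or, if no such
   direction exists, simply its lines, span the plane J = 0. It also fixes the
   vertex (0,0,0,1) of the cone at infinity. Comparing the parts of degree 2 and
   q + 1 in the affine equation, its linear part is, up to the field
   automorphism, a similarity both of alpha (X^2 + Y^2) and of e (N X + N Y);
   taking determinants gives N alpha / e^2 = N alpha' / e'^2, that is, the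
   equality of the deltas. Conversely such an equality provides, by Hilbert 90,
   a diagonal semilinear map. *)
Require Import Defs.
From HB Require Import structures.
From mathcomp Require Import all_boot all_order all_fingroup all_algebra all_field.
From mathcomp Require Import ring zify.
Set Implicit Arguments.
Unset Strict Implicit.
Unset Printing Implicit Defensive.
Import GRing.Theory.
Local Open Scope ring_scope.

(** * Coordinates in the four-dimensional space *)

Lemma sum_I4 (V : nmodType) (f : 'I_4 -> V) :
  \sum_i f i = f 0 + f 1 + f 2 + f 3.
Proof.
rewrite !big_ord_recl big_ord0 addr0 !addrA.
by congr (f _ + f _ + f _ + f _); apply: val_inj.
Qed.

Definition vec4 (F : pzRingType) (j x y z : F) : 'rV[F]_4 := \row_i [:: j; x; y; z]`_i.

Lemma vec4E (F : pzRingType) (j x y z : F) :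
  ((vec4 j x y z 0 0 = j) * (vec4 j x y z 0 1 = x) *
   (vec4 j x y z 0 2 = y) * (vec4 j x y z 0 3 = z))%type.
Proof. by rewrite !mxE. Qed.

Lemma row4P (F : pzRingType) (u v : 'rV[F]_4) :
  u 0 0 = v 0 0 -> u 0 1 = v 0 1 -> u 0 2 = v 0 2 -> u 0 3 = v 0 3 -> u = v.
Proof.
move=> e0 e1 e2 e3; apply/rowP => -[[|[|[|[|//]]]] lt_i].
- by rewrite (_ : Ordinal _ = 0) //; apply: val_inj.
- by rewrite (_ : Ordinal _ = 1) //; apply: val_inj.
- by rewrite (_ : Ordinal _ = 2) //; apply: val_inj.
by rewrite (_ : Ordinal _ = 3) //; apply: val_inj.
Qed.

Lemma mul_row4 (F : pzRingType) (u : 'rV[F]_4) (G : 'M[F]_4) k :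
  (u *m G) 0 k = u 0 0 * G 0 k + u 0 1 * G 1 k + u 0 2 * G 2 k + u 0 3 * G 3 k.
Proof. by rewrite mxE sum_I4. Qed.

(** * The equation of the variety and the lines it contains *)

Section Variety.
Variables (F : finFieldType) (q : nat) (c : {rmorphism F -> F}).
Hypotheses (cE : forall x, c x = x ^+ q) (q_gt2 : (2 < q)%N).
Hypotheses (cardF : #|F| = (q ^ 2)%N) (two_neq0 : 2%:R != 0 :> F).

Lemma conjK x : c (c x) = x.
Proof. by rewrite !cE -exprM mulnn -cardF expf_card. Qed.

(** As a polynomial in [t] the expression has degree at most 2q, less than the q^2 elements of [F]
    at which it vanishes, so it is zero. For q > 2 the six exponents 0, 1, 2, q, q + 1, 2q are
    distinct, so the coefficients can be read off. *)
Lemma six_term_eq0 (k0 k1 k2 kq kq1 k2q : F) :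
  (forall t, k0 + k1 * t + k2 * t ^+ 2 + kq * c t + kq1 * (t * c t)
             + k2q * c t ^+ 2 = 0) ->
  [/\ k1 = 0, k2 = 0 & kq1 = 0].
Proof.
move=> eq0.
pose P : {poly F} := \poly_(i < (2 * q).+1)
  (k0 *+ (i == 0%N) + k1 *+ (i == 1%N) + k2 *+ (i == 2%N)
   + kq *+ (i == q) + kq1 *+ (i == q.+1) + k2q *+ (i == (2 * q)%N)).
have hP t : P.[t] = 0.
  rewrite -(eq0 t) /P horner_poly.
  have pick (k : F) m : (m < (2 * q).+1)%N ->
      \sum_(i < (2 * q).+1) (k *+ (nat_of_ord i == m)) * t ^+ i = k * t ^+ m.
    move=> lt_m; rewrite (bigD1 (Ordinal lt_m)) //= eqxx big1 ?addr0 // => i.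
    by rewrite -val_eqE /= => /negPf ->; rewrite mul0r.
  under eq_bigr do rewrite !mulrDl.
  rewrite !big_split /= !pick; try lia.
  by rewrite expr0 mulr1 expr1 !cE -!exprM -exprS [(q * 2)%N]mulnC.
have P0 : P = 0.
  apply: (@roots_geq_poly_eq0 _ P (enum F)); first by apply/allP => t _; rewrite rootE hP.
    exact: enum_uniq.
  rewrite -cardE cardF; apply: leq_trans (size_poly _ _) _; nia.
have cf m : P`_m = 0 by rewrite P0 coef0.
have /[!coef_poly] c1 := cf 1%N.
have /[!coef_poly] c2 := cf 2.
have /[!coef_poly] cq1 := cf q.+1.
have neq (m n : nat) : m <> n -> (m == n) = false by move/eqP/negPf.
split; [move: c1 | move: c2 | move: cq1]; (rewrite ifT; last lia);
  by rewrite eqxx !neq ?addr0 ?add0r //; lia.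
Qed.

(* Here [e] stands for [beta ^+ q - beta]. *)
Definition affine_eq (a e x y z : F) : bool :=
  c z - z + (c (a * (x ^+ 2 + y ^+ 2)) - a * (x ^+ 2 + y ^+ 2))
  == e * (x * c x + y * c y).

Definition inM (a e : F) (v : 'rV[F]_4) : bool :=
  if v 0 0 == 0 then v 0 1 * c (v 0 1) + v 0 2 * c (v 0 2) == 0
  else affine_eq a e (v 0 1 / v 0 0) (v 0 2 / v 0 0) (v 0 3 / v 0 0).

Lemma inM_scale a e k v : k != 0 -> inM a e (k *: v) = inM a e v.
Proof.
move=> k0; rewrite /inM !mxE mulf_eq0 (negPf k0) /=.
case: eqP => [_|/eqP v0].
  rewrite !rmorphM -[RHS](mulrI_eq0 _ (mulfI (x := k * c k) _)).
    by congr (_ == 0); ring.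
  by rewrite mulf_neq0 // fmorph_eq0.
by rewrite !invfM !mulrA ![k * _ * k^-1]mulrAC !divff // !mul1r.
Qed.

(* The coefficients of [t ^+ 2], [t ^+ q.+1] and [t] in the equation along the
   line. *)
Lemma affine_line a e x y z u v w : c e = - e -> a != 0 -> e != 0 ->
  (forall t, affine_eq a e (x + t * u) (y + t * v) (z + t * w)) ->
  [/\ u ^+ 2 + v ^+ 2 = 0, u * c u + v * c v = 0 &
      w = - (2%:R * a * (x * u + y * v) + e * (c x * u + c y * v))].
Proof.
move=> ce a0 e0 aff.
case: (@six_term_eq0
  (c z - z + (c (a * (x ^+ 2 + y ^+ 2)) - a * (x ^+ 2 + y ^+ 2))
   - e * (x * c x + y * c y))
  (- (w + 2%:R * a * (x * u + y * v) + e * (c x * u + c y * v)))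
  (- (a * (u ^+ 2 + v ^+ 2)))
  (c w + 2%:R * c a * (c x * c u + c y * c v) - e * (x * c u + y * c v))
  (- (e * (u * c u + v * c v))) (c (a * (u ^+ 2 + v ^+ 2)))).
  move=> t; have /eqP  := aff t.
  move=> /eqP; rewrite -subr_eq0 => /eqP <-.
  ring.
move=> /eqP; rewrite oppr_eq0 -addrA addr_eq0 => /eqP ->.
move=> /eqP; rewrite oppr_eq0 mulf_eq0 (negPf a0) => /eqP uv.
by move=> /eqP; rewrite oppr_eq0 mulf_eq0 (negPf e0) => /eqP Nuv.
Qed.

(** Converse of [affine_line]: this [w] cancels the terms linear in [t] and [c t], and the other new
    terms are multiples of the two isotropy relations or of the conjugate of the first. *)
Lemma affine_line_sub a e x y z u v w t : c e = - e ->
  affine_eq a e x y z -> u ^+ 2 + v ^+ 2 = 0 -> u * c u + v * c v = 0 ->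
  w = - (2%:R * a * (x * u + y * v) + e * (c x * u + c y * v)) ->
  affine_eq a e (x + t * u) (y + t * v) (z + t * w).
Proof.
move=> ce /eqP aff uv Nuv ->; apply/eqP/subr0_eq.
have cuv : c u ^+ 2 + c v ^+ 2 = 0 by rewrite -!rmorphXn -rmorphD uv rmorph0.
have aff0 : c z - z + (c (a * (x ^+ 2 + y ^+ 2)) - a * (x ^+ 2 + y ^+ 2))
    - e * (x * c x + y * c y) = 0 by rewrite aff subrr.
transitivity ((c z - z + (c (a * (x ^+ 2 + y ^+ 2)) - a * (x ^+ 2 + y ^+ 2))
    - e * (x * c x + y * c y)) - a * t ^+ 2 * (u ^+ 2 + v ^+ 2)
    + c a * c t ^+ 2 * (c u ^+ 2 + c v ^+ 2)
    - e * t * c t * (u * c u + v * c v)).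
  rewrite !(rmorphD, rmorphN, rmorphM, rmorphXn, rmorph_nat) /= !conjK ce; ring.
by rewrite aff0 uv cuv Nuv; ring.
Qed.

(** A particular solution in z of the affine equation over [(x, y)] when [c e = - e]; the others
    differ from it by elements fixed by [c]. *)
Definition height a e x y : F :=
  - (a * (x ^+ 2 + y ^+ 2)) - e * (x * c x + y * c y) / 2%:R.

Lemma affine_height a e x y z : c e = - e ->
  affine_eq a e x y (height a e x y + z) = (c z == z).
Proof.
move=> ce; rewrite /affine_eq -subr_eq0 -[RHS]subr_eq0; congr (_ == 0).
rewrite /height !(rmorphD, rmorphN, rmorphM, rmorphXn, fmorphV, rmorph_nat) /=.
by rewrite !conjK ce; field.
Qed.

Lemma inM_affine a e x y z : inM a e (vec4 1 x y z) = affine_eq a e x y z.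
Proof. by rewrite /inM !vec4E oner_eq0 !divr1. Qed.

Lemma inM_infinity a e x y z :
  inM a e (vec4 0 x y z) = (x * c x + y * c y == 0).
Proof. by rewrite /inM !vec4E eqxx. Qed.

(** [P] and [D] may be proportional; this degenerate case is sorted out by the lemmas below. *)
Definition line_in a e (P D : 'rV[F]_4) : Prop :=
  forall s t, s *: P + t *: D != 0 -> inM a e (s *: P + t *: D).

Section Line.
Variables (a e : F).
Hypotheses (ce : c e = - e) (a0 : a != 0) (e0 : e != 0).

(** Subtracting from [D] the multiple of [P] with the same first coordinate leaves a direction at
    infinity, to which [affine_line] applies. *)
Lemma line_in_direction (P D : 'rV[F]_4) : P 0 0 != 0 -> line_in a e P D ->
  exists l u v w, [/\ D = l *: P + vec4 0 u v w, u ^+ 2 + v ^+ 2 = 0,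
    u * c u + v * c v = 0 &
    w = - (2%:R * a * (P 0 1 / P 0 0 * u + P 0 2 / P 0 0 * v)
           + e * (c (P 0 1 / P 0 0) * u + c (P 0 2 / P 0 0) * v))].
Proof.
move=> P0 PD; pose l := D 0 0 / P 0 0; pose E := D - l *: P.
have E0 : E 0 0 = 0 by rewrite !mxE /l divfK // subrr.
exists l, (E 0 1), (E 0 2), (E 0 3).
have DE : D = l *: P + E by rewrite addrC subrK.
case: (@affine_line a e (P 0 1 / P 0 0) (P 0 2 / P 0 0) (P 0 3 / P 0 0)
                    (E 0 1) (E 0 2) (E 0 3) ce a0 e0).
  move=> t; rewrite -inM_affine.
  (* The coefficient of [P] is chosen to make the first coordinate equal to 1. *)
  have -> : vec4 1 (P 0 1 / P 0 0 + t * E 0 1) (P 0 2 / P 0 0 + t * E 0 2)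
      (P 0 3 / P 0 0 + t * E 0 3) = ((P 0 0)^-1 - t * l) *: P + t *: D.
    by apply: row4P; rewrite vec4E /E !mxE /l; field.
  apply: PD; apply/eqP => /rowP/(_ 0); rewrite !mxE /l => /eqP.
  rewrite (_ : _ + _ = 1) ?oner_eq0 //; by field.
move=> uv Nuv wE; split=> //; rewrite {1}DE; congr (_ + _).
by apply: row4P; rewrite vec4E.
Qed.

(** A direction with [u != 0] gives [j = v / u]; if [u = 0], then [v] and [w] vanish too and the
    line degenerates to a point. *)
Lemma line_in_isotropic (P D : 'rV[F]_4) : P 0 0 != 0 -> line_in a e P D ->
  (exists2 j, j ^+ 2 = - 1 & j * c j = - 1) \/ exists l, D = l *: P.
Proof.
move=> P0 /(line_in_direction P0)[l [u [v [w [-> uv Nuv wE]]]]].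
have [u0|u0] := eqVneq u 0.
  right; exists l; move: uv wE; rewrite u0 expr0n add0r => /eqP.
  rewrite expf_eq0 /= => /eqP -> ->; rewrite !(mulr0, addr0) oppr0.
  suff -> : vec4 0 0 0 0 = 0 by rewrite addr0.
  by move=> R; apply: row4P; rewrite vec4E mxE.
have cu0 : c u != 0 by rewrite fmorph_eq0.
left; exists (v / u).
  by rewrite expr_div_n; apply: (mulIf (expf_neq0 2 u0));
     rewrite divfK ?expf_neq0 // mulN1r; apply/eqP; rewrite -addr_eq0 addrC uv.
rewrite fmorph_div mulrACA -invfM; apply: (mulIf (mulf_neq0 u0 cu0)).
by rewrite divfK ?mulf_neq0 // mulN1r; apply/eqP; rewrite -addr_eq0 addrC Nuv.
Qed.

(* At most two of the lines in the variety pass through an affine point. *)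
Lemma three_lines_in (P D1 D2 : 'rV[F]_4) : P 0 0 != 0 ->
  line_in a e P D1 -> line_in a e P D2 -> line_in a e P (D1 + D2) ->
  exists k0 k1 k2, (k1 != 0) || (k2 != 0) /\ k0 *: P + k1 *: D1 + k2 *: D2 = 0.
Proof.
move=> P0 /(line_in_direction P0)[l1 [u1 [v1 [w1 [-> uv1 _ w1E]]]]].
move=> /(line_in_direction P0)[l2 [u2 [v2 [w2 [-> uv2 _ w2E]]]]].
move=> /(line_in_direction P0)[l3 [u3 [v3 [w3 [/rowP E3 uv3 _ _]]]]].
have l3E : l3 = l1 + l2.
  move: (E3 0); rewrite !mxE /= !addr0 -mulrDl => H.
  exact/esym/(mulIf P0).
have u3E : u3 = u1 + u2 
  by apply: (addrI (l3 * P 0 1)); move: (E3 1); rewrite !mxE /= => <-; rewrite l3E; ring.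
have v3E : v3 = v1 + v2 
  by apply: (addrI (l3 * P 0 2)); move: (E3 2); rewrite !mxE /= => <-; rewrite l3E; ring.
(* Since the sum of the two directions is isotropic as well, polarization makes them orthogonal.
   Orthogonal isotropic vectors of a nondegenerate plane are proportional, and [w] depends linearly
   on [(u, v)]. *)
have uv12 : u1 * u2 + v1 * v2 = 0.
  apply: (mulfI two_neq0); rewrite mulr0 -uv3 u3E v3E.
  rewrite -[LHS]addr0 -[LHS]addr0 -{1}uv1 -uv2; ring.
have [u10|u10] := eqVneq u1 0.
  exists (- l1), 1, 0; rewrite oner_eq0 scale0r addr0 scale1r; split=> //.
  move: uv1; rewrite w1E u10 expr0n add0r => /eqP.
  rewrite expf_eq0 /= => /eqP ->; apply: row4P; rewrite !mxE /=; ring.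
have uv : u2 * v1 = u1 * v2.
  apply: (mulfI u10).
  have v12 : v1 ^+ 2 = - u1 ^+ 2 by apply/eqP; rewrite -addr_eq0 addrC uv1.
  transitivity (v1 * (u1 * u2 + v1 * v2) - v1 ^+ 2 * v2); first by ring.
  by rewrite uv12 v12; ring.
exists (u1 * l2 - u2 * l1), u2, (- u1); rewrite oppr_eq0 u10 orbT; split=> //.
apply: row4P; rewrite !mxE /=; first by ring.
- by ring.
- transitivity (u2 * v1 - u1 * v2); first by ring.
  by rewrite uv subrr.
rewrite w1E w2E.
transitivity (- (2%:R * a * (P 0 2 / P 0 0) + e * c (P 0 2 / P 0 0)) * (u2 * v1 - u1 * v2)).
  by ring.
by rewrite uv subrr mulr0.
Qed.
End Line.

(** * Linear collineations between two varieties *)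

Section Collineation.
Variables (a e a' e' u0 : F) (G : 'M[F]_4).
Hypotheses (ce : c e = - e) (ce' : c e' = - e').
Hypotheses (a'0 : a' != 0) (e0 : e != 0) (e'0 : e' != 0).
Hypothesis nondeg : 4%:R * (a * c a) + e ^+ 2 != 0.
Hypothesis Nu0 : u0 * c u0 = - 1.
Hypothesis Gunit : G \in unitmx.
Hypothesis GM : forall v, v != 0 -> inM a e v = inM a' e' (v *m G).

Let G_inj (v : 'rV_4) : v *m G = 0 -> v = 0.
Proof. by move=> vG; rewrite -[v](mulmxK Gunit) vG mul0mx. Qed.

Lemma line_in_mul P D : line_in a e P D -> line_in a' e' (P *m G) (D *m G).
Proof.
move=> PD s t; rewrite !scalemxAl -mulmxDl => PDG.
have PD0 : s *: P + t *: D != 0 by apply: contraNneq PDG => ->; rewrite mul0mx.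
by rewrite -GM // PD.
Qed.

(** The Hermitian form at infinity does not involve the last coordinate, so joining a point of the
    cone to the vertex gives a generator. *)
Lemma line_in_infinity r w : r * c r = - 1 ->
  line_in a e (vec4 0 1 r w) (vec4 0 0 0 1).
Proof.
move=> Nr s t _.
have -> : s *: vec4 0 1 r w + t *: vec4 0 0 0 1 = vec4 0 s (s * r) (s * w + t).
  by apply: row4P; rewrite !mxE /=; ring.
rewrite inM_infinity rmorphM; apply/eqP.
by transitivity (s * c s * (1 + r * c r)); [ring | rewrite Nr subrr mulr0].
Qed.

Lemma line_in_affine j x z w : j ^+ 2 = - 1 -> j * c j = - 1 -> c z = z ->
  w = - (2%:R * a * x + e * c x) ->
  line_in a e (vec4 0 1 j w) (vec4 1 x 0 (height a e x 0 + z)).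
Proof.
move=> j2 Nj cz wE s t PD.
have [t0|t0] := eqVneq t 0.
  rewrite t0 scale0r addr0.
  rewrite inM_scale ?inM_infinity ?Nj ?rmorph1 ?mulr1 ?subrr //.
  by apply: contraNneq PD => ->; rewrite t0 !scale0r addr0.
rewrite -(inM_scale _ _ _ (invr_neq0 t0)).
have -> : t^-1 *: (s *: vec4 0 1 j w + t *: vec4 1 x 0 (height a e x 0 + z))
   = vec4 1 (x + s / t * 1) (0 + s / t * j) (height a e x 0 + z + s / t * w).
  by apply: row4P; rewrite !mxE /=; field.
rewrite inM_affine; apply: affine_line_sub => //.
- by rewrite affine_height // cz.
- by rewrite j2 expr1n subrr.
- by rewrite Nj rmorph1 mulr1 subrr.
by rewrite wE rmorph0; ring.
Qed.

(* Through [vec4 0 1 r w] passes a line at infinity of the variety, so if its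
   image were affine, some [j] as below would exist; and then through
   [vec4 0 1 j w] pass three lines of the variety in the same plane. *)
Lemma infinity_image : exists2 r, r * c r = - 1 &
  forall w, (vec4 0 1 r w *m G) 0 0 = 0 /\ (vec4 0 1 (- r) w *m G) 0 0 = 0.
Proof.
have [/existsP[j /andP[/eqP j2 /eqP Nj]]|nj] :=
  boolP [exists j, (j ^+ 2 == - 1) && (j * c j == - 1)].
  exists j => //.
  suff im0 k w : k ^+ 2 = - 1 -> k * c k = - 1 -> (vec4 0 1 k w *m G) 0 0 = 0.
    move=> w; split; apply: im0 => //; first by rewrite sqrrN.
    by rewrite rmorphN mulrNN.
  move=> k2 Nk; apply/eqP/negPn/negP => P0.
  (* This solves the equation [wE] together with its conjugate, a linear system in [x] and [c x]
     whose determinant is nonzero by [nondeg]. *)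
  pose x := - (2%:R * c a * w - e * c w) / (4%:R * (a * c a) + e ^+ 2).
  have wE : w = - (2%:R * a * x + e * c x).
    rewrite /x fmorph_div.
    rewrite !(rmorph_nat, rmorphXn, rmorphD, rmorphN, rmorphM, fmorphV) /=.
    rewrite !conjK ce sqrrN [c a * a]mulrC; field.
    exact: nondeg.
  (* For [z = 0] and [z = 1] the affine points differ by the vertex, so with the generator [D1]
     these are three coplanar lines in the form required by [three_lines_in]. *)
  have D2 := line_in_mul (line_in_affine k2 Nk (rmorph0 c) wE).
  have D3 := line_in_mul (line_in_affine k2 Nk (rmorph1 c) wE).
  have D1 := line_in_mul (line_in_infinity (w := w) Nk).
  move: D3; rewrite addr0 in D2.
  have -> : vec4 1 x 0 (height a e x 0 + 1) =
      vec4 0 0 0 1 + vec4 1 x 0 (height a e x 0).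
    by apply: row4P; rewrite !mxE /= ?add0r // addrC.
  rewrite mulmxDl => D3.
  have [k0 [k1 [k3 [k13 lin]]]] := three_lines_in ce' a'0 e'0 P0 D1 D2 D3.
  move: lin; rewrite !scalemxAl -!mulmxDl => /G_inj/rowP lin.
  have := lin 0; rewrite !mxE /= !(mulr0, mulr1, add0r) => k30.
  have := lin 1; rewrite !mxE /= k30 !(mulr0, mul0r, mulr1, add0r, addr0) => k00.
  have := lin 3; rewrite !mxE /= k30 k00 !(mulr0, mul0r, mulr1, add0r, addr0).
  by move=> k10; rewrite k30 k10 eqxx in k13.
(* Without such a [j], [line_in_isotropic] allows no line through an affine point of the target, so
   the points on a generator cannot have affine images. *)
exists u0 => //.
suff im0 k w : k * c k = - 1 -> (vec4 0 1 k w *m G) 0 0 = 0.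
  move=> w; split; apply: im0 => //.
  by rewrite rmorphN mulrNN.
move=> Nk; apply/eqP/negPn/negP => P0.
have := line_in_mul (line_in_infinity (w := w) Nk).
move=> /(line_in_isotropic ce' a'0 e'0 P0)[[j j2 Nj]|[l /eqP]].
  by move/existsP: nj; apply; exists j; rewrite j2 Nj eqxx.
rewrite scalemxAl -subr_eq0 -mulmxBl => /eqP/G_inj/rowP lin.
have := lin 1; rewrite !mxE /= mulr1 add0r => /eqP; rewrite oppr_eq0 => /eqP l0.
have := lin 3; rewrite !mxE /= l0 mul0r subr0 => /eqP; by rewrite oner_eq0.
Qed.

(** The vectors [vec4 0 1 r w] and [vec4 0 1 (- r) w], for [w] equal to 0 and 1, span the plane at
    infinity; [G 0 0] is then nonzero because [G] is invertible. *)
Lemma fix_infinity : [/\ G 1 0 = 0, G 2 0 = 0, G 3 0 = 0 & G 0 0 != 0].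
Proof.
have [r Nr im] := infinity_image.
have r0 : r != 0 by apply: contra_eqN Nr => /eqP ->; rewrite mul0r eq_sym oppr_eq0 oner_eq0.
have := im 0; have := im 1.
rewrite !mul_row4 !vec4E !(mul0r, mul1r, add0r, addr0) => -[pos1 _] [pos0 neg0].
have G30 : G 3 0 = 0 by rewrite pos0 add0r in pos1.
have G10 : G 1 0 = 0.
  apply: (mulfI two_neq0); rewrite mulr0 -[RHS]addr0 -{1}pos0 -neg0; ring.
have G20 : G 2 0 = 0.
  by move: pos0; rewrite G10 add0r => /eqP; rewrite mulf_eq0 (negPf r0) => /eqP.
split=> //; apply/eqP => G00.
have : G *m (vec4 1 0 0 0)^T = 0.
  apply/colP => i; rewrite mxE sum_I4 !mxE /= !(mulr0, addr0) mulr1.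
  move: i => [[|[|[|[|//]]]] lt_i].
  - by rewrite -[RHS]G00; congr (G _ _); apply: val_inj.
  - by rewrite -[RHS]G10; congr (G _ _); apply: val_inj.
  - by rewrite -[RHS]G20; congr (G _ _); apply: val_inj.
  by rewrite -[RHS]G30; congr (G _ _); apply: val_inj.
move=> /(congr1 (mulmx (invmx G))); rewrite mulKmx // mulmx0 => /colP/(_ 0).
by rewrite !mxE => /eqP; rewrite oner_eq0.
Qed.

(* The vertex of the cone at infinity is the radical of its Hermitian form: the
   image [x] of the vertex satisfies [h x (x + t y) = 0] for the image [y] of
   every point of the cone. *)
Lemma fix_vertex : [/\ G 3 1 = 0, G 3 2 = 0 & G 3 3 != 0].
Proof.
have [G10 G20 G30 G00] := fix_infinity.
have orth r : r * c r = - 1 ->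
    (G 1 1 + r * G 2 1) * c (G 3 1) + (G 1 2 + r * G 2 2) * c (G 3 2) = 0
    /\ G 3 1 * c (G 3 1) + G 3 2 * c (G 3 2) = 0.
  move=> Nr.
  set p := G 1 1 + _; set s := G 1 2 + _.
  have cone t : (G 3 1 + t * p) * c (G 3 1 + t * p)
      + (G 3 2 + t * s) * c (G 3 2 + t * s) = 0.
    have v0 : vec4 0 t (t * r) 1 != 0.
      by apply/eqP => /rowP/(_ 3); rewrite !mxE => /eqP; rewrite oner_eq0.
    have := GM v0; rewrite inM_infinity rmorphM mulrACA Nr mulrN1 subrr eqxx.
    rewrite /inM !mul_row4 !vec4E G10 G20 G30 !(mulr0, mul0r, mul1r, add0r) eqxx.
    move=> /esym/eqP; rewrite /p /s => cone.
    by rewrite -[RHS]cone; ring.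
  case: (@six_term_eq0 (G 3 1 * c (G 3 1) + G 3 2 * c (G 3 2))
    (p * c (G 3 1) + s * c (G 3 2)) 0
    (c p * G 3 1 + c s * G 3 2) (p * c p + s * c s) 0) => [t|-> _ _].
    by rewrite -[RHS](cone t); ring.
  by have := cone 0; rewrite !mul0r !addr0.
(* The sum and difference of the relations for [u0] and [- u0] separate the rows 1 and 2 of [G]. *)
have [orth1 isot] := orth _ Nu0.
have [|orth2 _] := orth (- u0); first by rewrite rmorphN mulrNN.
have row1 : G 1 1 * c (G 3 1) + G 1 2 * c (G 3 2) = 0.
  apply: (mulfI two_neq0); rewrite mulr0 -[RHS]addr0 -{1}orth1 -orth2; ring.
have row2 : G 2 1 * c (G 3 1) + G 2 2 * c (G 3 2) = 0.
  have u0_neq0 : u0 != 0.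
    by apply: contra_eqN Nu0 => /eqP ->; rewrite mul0r eq_sym oppr_eq0 oner_eq0.
  apply: (mulfI u0_neq0); rewrite mulr0 -orth1 -[LHS]add0r -row1; ring.
(* Rows 1 to 3 of [G] annihilate the vector below whatever its first coordinate; [k] makes row 0
   annihilate it too. *)
pose k := (G 0 1 * c (G 3 1) + G 0 2 * c (G 3 2)) / G 0 0.
have ker : G *m (vec4 (- k) (c (G 3 1)) (c (G 3 2)) 0)^T = 0.
  apply/colP => i; rewrite mxE sum_I4 !mxE /= !(mulr0, addr0).
  move: i => [[|[|[|[|//]]]] lt_i].
  - rewrite (_ : Ordinal _ = 0); last exact: val_inj.
    by rewrite /k; field.
  - rewrite (_ : Ordinal _ = 1); last exact: val_inj.
    by rewrite G10 mul0r add0r row1.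
  - rewrite (_ : Ordinal _ = 2); last exact: val_inj.
    by rewrite G20 mul0r add0r row2.
  rewrite (_ : Ordinal _ = 3); last exact: val_inj.
  by rewrite G30 mul0r add0r isot.
move/(congr1 (mulmx (invmx G))): ker; rewrite mulKmx // mulmx0 => /colP ker.
have G31 : G 3 1 = 0.
  by have := ker 1; rewrite !mxE /= => /eqP; rewrite fmorph_eq0 => /eqP.
have G32 : G 3 2 = 0.
  by have := ker 2; rewrite !mxE /= => /eqP; rewrite fmorph_eq0 => /eqP.
split=> //; apply/eqP => G33.
have /G_inj/rowP/(_ 3) : vec4 0 0 0 1 *m G = 0.
  by apply: row4P; rewrite mul_row4 !vec4E !(mul0r, add0r) mul1r mxE.
by rewrite !mxE => /eqP; rewrite oner_eq0.
Qed.

Let h i j := G i j / G 0 0.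

Lemma affine_image x y z : affine_eq a e x y z ->
  affine_eq a' e' (h 0 1 + (x * h 1 1 + y * h 2 1))
    (h 0 2 + (x * h 1 2 + y * h 2 2))
    (h 0 3 + (x * h 1 3 + y * h 2 3) + z * h 3 3).
Proof.
have [G10 G20 G30 G00] := fix_infinity; have [G31 G32 _] := fix_vertex.
rewrite -inM_affine GM; last first.
  by apply/eqP => /rowP/(_ 0); rewrite !mxE => /eqP; rewrite oner_eq0.
rewrite /inM !mul_row4 !vec4E G10 G20 G30 G31 G32.
rewrite !(mulr0, mul1r, addr0) (negPf G00) /h.
by congr (is_true (affine_eq _ _ _ _ _)); field.
Qed.

(** The points over [x = y = 0] with [z = 0] and [z = 1] have images differing by [h 3 3] in the
    last coordinate only, which enters the equation through [c z - z]. *)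
Lemma fixed_scale : c (h 3 3) = h 3 3.
Proof.
have aff0 z : c z = z -> affine_eq a e 0 0 z.
  move=> cz; have -> : z = height a e 0 0 + z.
    by rewrite /height rmorph0; ring.
  by rewrite affine_height // cz.
have /eqP := affine_image (aff0 _ (rmorph0 c)).
have /eqP := affine_image (aff0 _ (rmorph1 c)).
rewrite !(mul0r, addr0) mul1r => <-.
move/eqP; rewrite -subr_eq0 => /eqP H; apply/eqP; rewrite -subr_eq0.
by apply/eqP; rewrite -[RHS]oppr0 -H; ring.
Qed.

(** Apply the map to the points at [height] over [(t * x, t * y)]. Translations and the term [l]
    affect only the constant term and the coefficients of [t] and [c t], so those of [t ^+ 2] and
    [t * c t] compare the forms. *)
Lemma similarity x y :
  let x' := x * h 1 1 + y * h 2 1 in let y' := x * h 1 2 + y * h 2 2 in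
  a' * (x' ^+ 2 + y' ^+ 2) = h 3 3 * a * (x ^+ 2 + y ^+ 2) /\
  e' * (x' * c x' + y' * c y') = h 3 3 * e * (x * c x + y * c y).
Proof.
move=> x' y'; set b1 := h 0 1; set b2 := h 0 2; set k := h 3 3.
set l := x * h 1 3 + y * h 2 3; set m := h 0 3.
have ck : c k = k := fixed_scale.
have aff t : affine_eq a' e' (b1 + t * x') (b2 + t * y')
   (m + t * l + height a e (t * x) (t * y) * k).
  have : affine_eq a e (t * x) (t * y) (height a e (t * x) (t * y) + 0).
    by rewrite affine_height // rmorph0.
  move/affine_image; rewrite addr0; congr (is_true (affine_eq _ _ _ _ _)).
  - by rewrite /x' /b1; ring.
  - by rewrite /y' /b2; ring.
  by rewrite /l /m /k; ring.
clearbody b1 b2 k l m x' y'.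
case: (@six_term_eq0
  (c m - m + (c (a' * (b1 ^+ 2 + b2 ^+ 2)) - a' * (b1 ^+ 2 + b2 ^+ 2))
    - e' * (b1 * c b1 + b2 * c b2))
  (- (l + 2%:R * a' * (b1 * x' + b2 * y') + e' * (c b1 * x' + c b2 * y')))
  (k * a * (x ^+ 2 + y ^+ 2) - a' * (x' ^+ 2 + y' ^+ 2))
  (c l + 2%:R * c a' * (c b1 * c x' + c b2 * c y') - e' * (b1 * c x' + b2 * c y'))
  (k * e * (x * c x + y * c y) - e' * (x' * c x' + y' * c y'))
  (c (a' * (x' ^+ 2 + y' ^+ 2) - k * a * (x ^+ 2 + y ^+ 2)))).
  move=> t; have /eqP/eqP := aff t; rewrite -subr_eq0 => /eqP <-.
  rewrite /height.
  rewrite !(rmorph_nat, rmorphXn, rmorphD, rmorphN, rmorphM, fmorphV) /=.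
  by rewrite !conjK ce ck; field.
by move=> _ /subr0_eq -> /subr0_eq ->.
Qed.

(* Lagrange's identity, once for [x ^+ 2 + y ^+ 2] and once for
   [x * c x + y * c y]. *)
Lemma collineation_norm : a * c a * e' ^+ 2 = a' * c a' * e ^+ 2.
Proof.
have [_ _ _ G00] := fix_infinity; have [_ _ G33] := fix_vertex.
set k := h 3 3; have k0 : k != 0 by rewrite mulf_neq0 ?invr_neq0.
have ck : c k = k := fixed_scale.
(* The basis vectors give the diagonal values of the forms; [(1, 1)] and [(e, 1)] give the polar
   values. *)
have [] := (similarity 1 0, similarity 0 1).
have [] := (similarity 1 1, similarity e 1).
rewrite /= -/k.
set p1 := h 1 1; set p2 := h 2 1; set q1 := h 1 2; set q2 := h 2 2.
rewrite !(mul0r, mul1r, addr0, add0r, rmorph0, rmorph1, expr1n, expr0n) /=.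
rewrite !mulr1 => -[Q11 H11] [_ He1] [Q10 H10] [Q01 H01].
clearbody k p1 p2 q1 q2.
have Q : a' * (p1 * p2 + q1 * q2) = 0.
  apply: (mulfI two_neq0); rewrite mulr0.
  transitivity (a' * ((p1 + p2) ^+ 2 + (q1 + q2) ^+ 2)
    - a' * (p1 ^+ 2 + q1 ^+ 2) - a' * (p2 ^+ 2 + q2 ^+ 2)); first by ring.
  by rewrite Q11 Q10 Q01; ring.
(* From [(1, 1)] comes [K + c K = 0], and from [(e, 1)], because [c e = - e], comes
   [K - c K = 0]. *)
have K : p1 * c p2 + q1 * c q2 = 0.
  set K := _ + _.
  have K1 : K + c K = 0.
    apply: (mulfI e'0); rewrite mulr0.
    transitivity (e' * ((p1 + p2) * c (p1 + p2) + (q1 + q2) * c (q1 + q2))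
      - e' * (p1 * c p1 + q1 * c q1) - e' * (p2 * c p2 + q2 * c q2)).
      by rewrite /K !(rmorphD, rmorphM) /= !conjK; ring.
    by rewrite H11 H10 H01; ring.
  have K2 : K - c K = 0.
    apply: (mulfI (mulf_neq0 e0 e'0)); rewrite mulr0.
    transitivity (e' * ((e * p1 + p2) * c (e * p1 + p2)
        + (e * q1 + q2) * c (e * q1 + q2))
      + e * e * (e' * (p1 * c p1 + q1 * c q1)) - e' * (p2 * c p2 + q2 * c q2)).
      by rewrite /K !(rmorphD, rmorphM) /= !conjK ce; ring.
    by rewrite He1 H10 H01 ce; ring.
  by apply: (mulfI two_neq0); rewrite mulr0 -[RHS]addr0 -{1}K1 -K2; ring.
pose D := p1 * q2 - p2 * q1.
have QD : (a' * D) ^+ 2 = (k * a) ^+ 2.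
  transitivity (a' * (p1 ^+ 2 + q1 ^+ 2) * (a' * (p2 ^+ 2 + q2 ^+ 2))
                - (a' * (p1 * p2 + q1 * q2)) ^+ 2); first by rewrite /D; ring.
  by rewrite Q Q10 Q01; ring.
have HD : e' ^+ 2 * (D * c D) = (k * e) ^+ 2.
  transitivity (e' * (p1 * c p1 + q1 * c q1) * (e' * (p2 * c p2 + q2 * c q2))
    - e' ^+ 2 * ((p1 * c p2 + q1 * c q2) * c (p1 * c p2 + q1 * c q2))).
    by rewrite /D !(rmorphD, rmorphN, rmorphM) /= !conjK; ring.
  by rewrite K H10 H01; ring.
have ND : a' * c a' * (D * c D) = k ^+ 2 * (a * c a).
  (* [QD] determines [a' * D] only up to sign, which the norm does not see. *)
  have N : a' * D * c (a' * D) = k * a * c (k * a).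
    have /eqP := QD; rewrite eqf_sqr => /orP[] /eqP -> //.
    by rewrite rmorphN mulrNN.
  by move: N; rewrite !rmorphM ck => N; rewrite mulrACA -[in LHS]rmorphM /= rmorphM N; ring.
apply: (mulfI (expf_neq0 2 k0)).
transitivity (e' ^+ 2 * (k ^+ 2 * (a * c a))); first by ring.
by rewrite -ND mulrCA HD; ring.
Qed.
End Collineation.
End Variety.

(** * Field automorphisms and semilinear maps acting on points *)

Lemma rmorphism_expp (F : finFieldType) (p n q : nat) :
  prime p -> q = (p ^ n)%N -> #|F| = (q ^ 2)%N ->
  exists c : {rmorphism F -> F}, forall x, c x = x ^+ q.
Proof.
move=> p_pr -> cardF.
have pF : p \in [pchar F] by apply: (@card_finPcharP F p (n * 2)); rewrite // expnM.
elim: n {cardF} => [|n [c cE]]; first by exists idfun => x; rewrite expr1.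
exists (pFrobenius_aut pF \o c) => x.
by rewrite /= pFrobenius_autE cE -exprM expnSr.
Qed.

Lemma semilinearE (R : fieldType) (U V : lmodType R) (s : {rmorphism R -> R})
    (f : U -> V) :
  (forall k u v, f (k *: u + v) = s k *: f u + f v) ->
  exists g : {linear U -> V | s \; *:%R}, g =1 f.
Proof.
move=> fL; pose L := GRing.isLinear.Build R U V (s \; *:%R) f fL.
by exists (HB.pack_for {linear U -> V | s \; *:%R} f L).
Qed.

Section Points.
Variable F : finFieldType.

Lemma point_line (P : point F) v : v != 0 -> v \in line_of P -> line_of P = <[v]>%VS.
Proof.
case: P => U /= dimU v0 vU; apply/esym/eqP.
by rewrite eqEdim -memvE vU dim_vline v0 (eqP dimU).
Qed.

Lemma point_of_vec (v : 'rV[F]_4) : v != 0 -> exists P : point F, v \in line_of P.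
Proof.
move=> v0; have dimv : \dim <[v]>%VS == 1%N by rewrite dim_vline v0.
by exists (Point dimv); rewrite memv_line.
Qed.

Lemma vec_of_point (P : point F) : exists2 v, v != 0 & v \in line_of P.
Proof.
exists (vpick (line_of P)); last exact: memv_pick.
by rewrite vpick0 -dimv_eq0; case: P => U /= /eqP ->.
Qed.

(** Homogeneity makes the test independent of the representative. *)
Lemma mem_locus (E : F -> F -> F -> F -> bool) (P : point F) v :
  (forall k j x y z, k != 0 -> E (k * j) (k * x) (k * y) (k * z) = E j x y z) ->
  v != 0 -> v \in line_of P ->
  (P \in locus E) = E (v 0 0) (v 0 1) (v 0 2) (v 0 3).
Proof.
move=> E_hom v0 vP; rewrite inE; apply/existsP/idP => [[w]|Ev]; last first.
  by exists v; rewrite v0 vP.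
rewrite (point_line v0 vP) => /and3P[w0 /vlineP[k def_w]].
rewrite def_w !mxE E_hom //.
by apply: contraNneq w0 => k0; rewrite def_w k0 scale0r.
Qed.

Lemma semilinear_perm (s : {rmorphism F -> F})
    (f : {linear 'rV[F]_4 -> 'rV[F]_4 | s \; *:%R}) :
  bijective s -> injective f ->
  exists psi : {perm point F},
    forall (P : point F) v, v \in line_of P -> f v \in line_of (psi P).
Proof.
move=> [s' sK s'K] f_inj.
have f0 v : v != 0 -> f v != 0 by rewrite -(inj_eq f_inj) linear0.
have ex P : exists Q : point F, [forall v in line_of P, f v \in line_of Q].
  have [v v0 vP] := vec_of_point P; have [Q vQ] := point_of_vec (f0 _ v0).
  exists Q; apply/forall_inP => w; rewrite (point_line v0 vP) => /vlineP[k ->].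
  by rewrite linearZ /= memvZ.
pose psi P := xchoose (ex P).
have psiP P v : v \in line_of P -> f v \in line_of (psi P).
  by have /forall_inP := xchooseP (ex P); apply.
suff psi_inj : injective psi by exists (perm psi_inj) => P v; rewrite permE; apply: psiP.
move=> P Q eqPQ; apply: val_inj => /=.
have [v v0 vP] := vec_of_point P; have [w w0 wQ] := vec_of_point Q.
have := psiP P v vP; rewrite eqPQ (point_line (f0 _ w0) (psiP Q w wQ)).
(* The scalar is pulled back through [s], which uses its surjectivity. *)
move=> /vlineP[k]; rewrite -[k]s'K => fv.
have vw : v = s' k *: w by apply: f_inj; rewrite linearZ.
have vQ : v \in line_of Q by rewrite vw memvZ.
by rewrite (point_line v0 vP) (point_line v0 vQ).
Qed.
End Points.

(** * From sets of points to equations on vectors *)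

Section Equivalence.
Variables (F : finFieldType) (q : nat) (c : {rmorphism F -> F}).
Hypotheses (cE : forall x, c x = x ^+ q) (q_gt0 : (0 < q)%N).

Lemma mem_M_set (alpha beta : F) (P : point F) v :
  v != 0 -> v \in line_of P ->
  (P \in M_set q alpha beta) = inM c alpha (beta ^+ q - beta) v.
Proof.
move=> v0 vP; rewrite in_setU in_setD.
have exp2q x : x ^+ (2 * q) = c x ^+ 2 by rewrite cE -exprM mulnC.
rewrite !(@mem_locus _ _ P v) //; first last.
- by move=> k j x y z k0; rewrite mulf_eq0 (negPf k0).
(* Both sides of the equation are homogeneous of degree 2q. *)
- move=> k j x y z k0.
  have kq : k ^+ q = k * k ^+ (q - 1) by rewrite -exprS subn1 prednK.
  rewrite -[RHS](inj_eq (mulfI (expf_neq0 (2 * q) k0))).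
  rewrite !exprMn; congr (_ == _).
    have -> : k ^+ (2 * q) = k ^+ 2 * k ^+ (2 * q - 2).
      by rewrite -exprD; congr (_ ^+ _); lia.
    have -> : k ^+ (2 * q - 1) = k * k ^+ (2 * q - 2).
      by rewrite -exprS; congr (_ ^+ _); lia.
    have -> : k ^+ q * z ^+ q * (k ^+ q * j ^+ q) = k ^+ (2 * q) * (z ^+ q * j ^+ q).
      by rewrite mul2n -addnn exprD; ring.
    have -> : k ^+ (2 * q) = k ^+ 2 * k ^+ (2 * q - 2).
      by rewrite -exprD; congr (_ ^+ _); lia.
    by ring.
  have -> : k ^+ (2 * q) = k ^+ q.+1 * k ^+ (q - 1).
    by rewrite -exprD; congr (_ ^+ _); lia.
  by ring.
- move=> k j x y z k0; rewrite mulf_eq0 (negPf k0) !exprMn -mulrDr mulf_eq0.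
  by rewrite expf_eq0 /= (negPf k0).
rewrite /inM; have [//|j0] := eqVneq (v 0 0) 0; first by rewrite !exprS -!cE.
rewrite orbF /affine_eq; move: (v 0 0) (v 0 1) (v 0 2) (v 0 3) j0 => j x y z j0.
have cj0 : c j != 0 by rewrite fmorph_eq0.
have jq1 : j ^+ (q - 1) = c j / j.
  by apply: (mulIf j0); rewrite divfK // cE -exprSr subn1 prednK.
have j2q1 : j ^+ (2 * q - 1) = c j ^+ 2 / j.
  by apply: (mulIf j0); rewrite divfK // -exp2q -exprSr; congr (_ ^+ _); lia.
have j2q2 : j ^+ (2 * q - 2) = c j ^+ 2 / j ^+ 2.
  apply: (mulIf (expf_neq0 2 j0)); rewrite divfK ?expf_neq0 // -exp2q -exprD.
  by congr (_ ^+ _); lia.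
rewrite jq1 j2q1 j2q2 !exp2q ![_ ^+ q.+1]exprS -!cE.
(* The projective equation is the affine one multiplied by [c j ^+ 2], the power of J of exponent
   2q. *)
rewrite -subr_eq0 -[RHS]subr_eq0 -[RHS](mulrI_eq0 _ (mulfI (expf_neq0 2 cj0))).
congr (_ == 0); set e := _ - beta.
rewrite !(rmorphXn, rmorphD, rmorphM, fmorphV) /=.
by field; rewrite cj0.
Qed.

(** Both sides are multiplied by [k], which passes through [c] because it is fixed by it. *)
Lemma affine_eq_scale (a e a' e' k l x y z : F) : k != 0 -> c k = k ->
  a' * l ^+ 2 = k * a -> e' * (l * c l) = k * e ->
  affine_eq c a' e' (l * x) (l * y) (k * z) = affine_eq c a e x y z.
Proof.
move=> k0 ck al el; rewrite /affine_eq.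
have -> : a' * ((l * x) ^+ 2 + (l * y) ^+ 2) = k * (a * (x ^+ 2 + y ^+ 2)).
  by rewrite mulrA -al; ring.
rewrite -[RHS](inj_eq (mulfI k0)) !(rmorphM c k) ck; congr (_ == _); first by ring.
by rewrite mulrA -el !(rmorphM c l); ring.
Qed.

(** [c] is a power map, so every automorphism commutes with it. *)
Lemma inM_map (s : {rmorphism F -> F}) a e v :
  inM c (s a) (s e) (map_mx s v) = inM c a e v.
Proof.
have sc x : c (s x) = s (c x) by rewrite !cE rmorphXn.
rewrite /inM !mxE fmorph_eq0; case: ifP => _.
  by rewrite !sc -!rmorphM -rmorphD fmorph_eq0.
rewrite -!fmorph_div /affine_eq -[RHS](inj_eq (fmorph_inj s)).
move: (v 0 1 / _) (v 0 2 / _) (v 0 3 / _) => x y z.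
by rewrite !(rmorphB, rmorphD, rmorphXn, rmorphM) /= !sc.
Qed.

Lemma mem_M_set_map (psi : {perm point F}) (s : {rmorphism F -> F})
    (f : {linear 'rV[F]_4 -> 'rV[F]_4 | s \; *:%R}) alpha beta alpha' beta' :
  injective f ->
  (forall (P : point F) v, v \in line_of P -> f v \in line_of (psi P)) ->
  psi @: M_set q alpha beta = M_set q alpha' beta' <->
  forall v, v != 0 -> inM c alpha (beta ^+ q - beta) v
                      = inM c alpha' (beta' ^+ q - beta') (f v).
Proof.
move=> f_inj psiP.
have f0 v : v != 0 -> f v != 0 by rewrite -(inj_eq f_inj) linear0.
split=> [eqM v v0|eqM].
  have [P vP] := point_of_vec v0.
  rewrite -(mem_M_set _ _ v0 vP) -(mem_M_set _ _ (f0 _ v0) (psiP _ _ vP)) -eqM.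
  by rewrite mem_imset //; apply: perm_inj.
apply/setP => Q; rewrite -[Q](permKV psi) mem_imset; last exact: perm_inj.
have [v v0 vP] := vec_of_point ((psi^-1)%g Q).
by rewrite (mem_M_set _ _ v0 vP) (mem_M_set _ _ (f0 _ v0) (psiP _ _ vP)) eqM.
Qed.
End Equivalence.

(** * Equivalence of varieties and equality of norms *)

Section Converse.
Variables (F : finFieldType) (q : nat) (c : {rmorphism F -> F}).
Hypotheses (cE : forall x, c x = x ^+ q) (q_gt0 : (0 < q)%N).
Hypothesis cK : involutive c.

(** The witness [1 + mu] vanishes only for [mu = - 1], and there [e] serves. *)
Lemma hilbert90 e mu : c e = - e -> e != 0 -> mu * c mu = 1 ->
  exists2 l, l != 0 & l = mu * c l.
Proof.
move=> ce e0 Nmu; have [->|mu1] := eqVneq mu (- 1).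
  by exists e; rewrite // ce mulrNN mul1r.
exists (1 + mu); last by rewrite rmorphD rmorph1 mulrDr mulr1 Nmu addrC.
by rewrite addrC addr_eq0.
Qed.

(** The map is [s] followed by the diagonal matrix with entries 1, [l], [l], [k]. Matching the
    Hermitian parts forces [k = l * c l / k0]; matching the quadratic parts then becomes
    [l = mu * c l], solvable since [mu] has norm 1. *)
Lemma equivalent_of_norm (s : {rmorphism F -> F}) alpha alpha' beta :
  bijective s -> alpha != 0 -> alpha' != 0 -> beta ^+ q != beta ->
  let d := beta ^+ q - beta in
  s alpha * c (s alpha) * d ^+ 2 = alpha' * c alpha' * s d ^+ 2 ->
  equivalent (M_set q alpha beta) (M_set q alpha' beta).
Proof.
move=> s_bij al0 al'0 beta_q d Nd.
have d0 : d != 0 by rewrite subr_eq0.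
have cd : c d = - d by rewrite /d -cE rmorphB cK opprB.
have csd : c (s d) = - s d by rewrite !cE -rmorphXn -cE cd rmorphN.
have sd0 : s d != 0 by rewrite fmorph_eq0.
pose k0 := s d / d; have k00 : k0 != 0 by rewrite mulf_neq0 ?invr_neq0.
have ck0 : c k0 = k0 by rewrite fmorph_div csd cd invrN mulrNN.
have sal0 : s alpha != 0 by rewrite fmorph_eq0.
pose mu := s alpha / (k0 * alpha').
have Nmu : mu * c mu = 1.
  have cal'0 : c alpha' != 0 by rewrite fmorph_eq0.
  have N : s alpha * c (s alpha) = k0 * alpha' * (k0 * c alpha').
    by apply: (mulIf (expf_neq0 2 d0)); rewrite Nd /k0; field.
  rewrite /mu fmorph_div rmorphM /= ck0 mulrACA N -invfM divff //.
  exact: mulf_neq0 (mulf_neq0 k00 al'0) (mulf_neq0 k00 cal'0).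
have [l l0 lE] := hilbert90 cd d0 Nmu.
have cl0 : c l != 0 by rewrite fmorph_eq0.
pose k := l * c l / k0.
have k_neq0 : k != 0 by rewrite !mulf_neq0 ?invr_neq0.
have ck : c k = k by rewrite fmorph_div rmorphM /= cK ck0 [c l * l]mulrC.
have quad : alpha' * l ^+ 2 = k * s alpha.
  rewrite expr2 {2}lE /mu /k; field.
  by rewrite k00.
have herm : d * (l * c l) = k * s d by rewrite /k /k0; field; rewrite d0.
pose f (v : 'rV[F]_4) :=
  vec4 (s (v 0 0)) (l * s (v 0 1)) (l * s (v 0 2)) (k * s (v 0 3)).
have [|g gE] := @semilinearE _ _ _ s f.
  move=> t u v; apply: row4P; rewrite !mxE /= ?(rmorphD, rmorphM) /=; ring.
have g_inj : injective g.
  move=> u v; rewrite !gE => /rowP fuv; apply: row4P; apply: (fmorph_inj s).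
  - by have := fuv 0; rewrite !mxE.
  - by have := fuv 1; rewrite !mxE => /(mulfI l0).
  - by have := fuv 2; rewrite !mxE => /(mulfI l0).
  by have := fuv 3; rewrite !mxE => /(mulfI k_neq0).
have [psi psiP] := semilinear_perm s_bij g_inj.
exists psi; first by exists s; split=> //; exists g; split=> //; exact: injF_bij.
apply/(mem_M_set_map cE q_gt0 _ _ _ _ g_inj psiP) => v _.
rewrite -/d gE -(inM_map cE s) /inM vec4E !vec4E !mxE; case: ifP => _.
  rewrite !rmorphM /= [l * _ * _]mulrACA [l * s (v 0 2) * _]mulrACA -mulrDr.
  by rewrite mulf_eq0 !mulf_eq0 (negPf l0) (negPf cl0).
by rewrite -(affine_eq_scale _ _ _ k_neq0 ck quad herm) !(mulrA l) (mulrA k).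
Qed.

(** A semilinear map is [s] on coordinates followed by a matrix [G]. Moving [s] into the
    coefficients makes [G] a linear collineation from the variety of [s alpha] and [s d] to that of
    [alpha'] and [d]. *)
Lemma norm_of_equivalent (alpha alpha' beta u : F) :
  (2 < q)%N -> #|F| = (q ^ 2)%N -> 2%:R != 0 :> F -> u ^+ q.+1 = - 1 ->
  is_BM q alpha beta -> is_BM q alpha' beta ->
  let d := beta ^+ q - beta in
  equivalent (M_set q alpha beta) (M_set q alpha' beta) ->
  exists s : {rmorphism F -> F}, bijective s /\
    s alpha * c (s alpha) * d ^+ 2 = alpha' * c alpha' * s d ^+ 2.
Proof.
move=> q_gt2 cardF two_neq0 Nu /and3P[al0 beta_q nd] /and3P[al'0 _ _] d.
move=> [psi [s [s_bij [f [f_bij psiP]]]] eqM]; exists s; split=> //.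
have f_inj := bij_inj f_bij.
have fM := (mem_M_set_map cE q_gt0 _ _ _ _ f_inj psiP).1 eqM.
have d0 : d != 0 by rewrite subr_eq0.
have cd : c d = - d by rewrite /d -cE rmorphB cK opprB.
have csd : c (s d) = - s d by rewrite !cE -rmorphXn -cE cd rmorphN.
have [s' sK s'K] := s_bij.
pose G : 'M[F]_4 := \matrix_(i, j) f (delta_mx 0 i) 0 j.
have fG v : f v = map_mx s v *m G.
  rewrite [v in LHS]row_sum_delta linear_sum; apply/rowP => j.
  by rewrite !mxE summxE; apply: eq_bigr => i _; rewrite linearZ /= !mxE.
have mapK w : map_mx s (map_mx s' w) = w :> 'rV_4.
  by apply/rowP => i; rewrite !mxE s'K.
have Ginj (w : 'rV_4) : w *m G = 0 -> w = 0.
  rewrite -[w]mapK -fG => /eqP; rewrite -(linear0 f) (inj_eq f_inj) => /eqP ->.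
  by rewrite map_mx0 linear0.
have Gunit : G \in unitmx.
  rewrite -row_free_unit -kermx_eq0; apply/eqP/row_matrixP => i.
  by rewrite row0; apply: Ginj; rewrite -row_mul mulmx_ker row0.
apply: (@collineation_norm F q c cE q_gt2 cardF two_neq0 _ (s d) _ d u G) => //.
- by rewrite fmorph_eq0.
- rewrite cE -exprS -!rmorphXn -(rmorph_nat s 4) -rmorphM -rmorphD fmorph_eq0.
  exact: nd.
- by rewrite cE -exprS.
move=> w w0; rewrite -[w]mapK (inM_map cE) -fG; apply: fM.
by apply: contraNneq w0 => w'0; rewrite -[w]mapK w'0 map_mx0.
Qed.
End Converse.

(** * The theorem *)

(** The exponent [q./2] is (q - 1)/2, so the power in question is [eps] to half its order, a square
    root of 1 other than 1. *)
Lemma norm_minus1 (F : finFieldType) (q : nat) (eps : F) :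
  odd q -> (1 < q)%N -> (q ^ 2 - 1)%N.-primitive_root eps ->
  exists u : F, u ^+ q.+1 = - 1.
Proof.
move=> q_odd q_gt1 eps_prim; exists (eps ^+ q./2); rewrite -exprM.
have m2 : (q./2 * q.+1 * 2 = q ^ 2 - 1)%N.
  by have := odd_double_half q; rewrite q_odd; nia.
have /eqP : (eps ^+ (q./2 * q.+1)) ^+ 2 = 1 by rewrite -exprM m2 prim_expr_order.
rewrite sqrf_eq1 => /orP[|/eqP //]; rewrite -(prim_order_dvd eps_prim) -m2.
by move/dvdn_leq; nia.
Qed.

Theorem lemma5p6 (p n q : nat) (F : finFieldType) (eps alpha alpha' : F)
    (p_prime : prime p) (p_odd : odd p) (n_gt0 : (0 < n)%N)
    (q_def : q = (p ^ n)%N) (cardF : #|F| = (q ^ 2)%N)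
    (eps_prim : (q ^ 2 - 1)%N.-primitive_root eps)
    (BM : is_BM q alpha eps) (BM' : is_BM q alpha' eps) :
  equivalent (M_set q alpha eps) (M_set q alpha' eps) <->
  exists sigma : {rmorphism F -> F},
    bijective sigma /\ delta q eps alpha' = sigma (delta q eps alpha).
Proof.
have [c cE] := rmorphism_expp p_prime q_def cardF.
have q_odd : odd q by rewrite q_def oddX p_odd orbT.
have q_gt1 : (1 < q)%N by rewrite q_def -(exp1n n) ltn_exp2r ?prime_gt1.
have q_gt2 : (2 < q)%N by case: q q_gt1 q_odd {cE eps_prim BM BM' cardF q_def} => [|[|[|]]].
have two_neq0 : 2%:R != 0 :> F.
  have pF : p \in [pchar F].
    by apply: (@card_finPcharP F p (n * 2)); rewrite // expnM -q_def.
  by rewrite -(dvdn_pcharf pF) gtnNdvd // odd_prime_gt2.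
have al0 : alpha != 0 by case/and3P: BM.
have al'0 : alpha' != 0 by case/and3P: BM'.
have eps_q : eps ^+ q != eps by case/and3P: BM.
have four_neq0 : 4%:R != 0 :> F by rewrite (natrM F 2 2) mulf_neq0.
(* For each fixed [s], clearing denominators turns the equality of deltas into the equality of norms
   used above. *)
have deltaP (s : {rmorphism F -> F}) : let d := eps ^+ q - eps in
    s alpha * c (s alpha) * d ^+ 2 = alpha' * c alpha' * s d ^+ 2 <->
    delta q eps alpha' = s (delta q eps alpha).
  move=> d; have N0 x : x != 0 -> 4%:R * (x * c x) != 0.
    by move=> x0; rewrite !mulf_neq0 // fmorph_eq0.
  have -> : s (delta q eps alpha) = s d ^+ 2 / (4%:R * (s alpha * c (s alpha))).
    rewrite /delta fmorph_div (rmorphM s 4%:R) rmorph_nat cE -exprS.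
    by rewrite (rmorphXn s 2) (rmorphXn s q.+1).
  rewrite /delta [alpha' ^+ _]exprS -(cE alpha') -/d.
  split=> [H|/eqP].
    apply/eqP; rewrite eqr_div ?N0 ?fmorph_eq0 //; apply/eqP.
    transitivity (4%:R * (s alpha * c (s alpha) * d ^+ 2)); first by ring.
    by rewrite H; ring.
  rewrite eqr_div ?N0 ?fmorph_eq0 // => /eqP H; apply: (mulfI four_neq0).
  transitivity (d ^+ 2 * (4%:R * (s alpha * c (s alpha)))); first by ring.
  by rewrite H; ring.
have q_gt0 := ltnW q_gt1.
have cK := conjK cE cardF.
split=> [|[s [s_bij /deltaP]]]; last exact: equivalent_of_norm.
have [u Nu] := norm_minus1 q_odd q_gt1 eps_prim.
move=> /(norm_of_equivalent cE q_gt0 cK q_gt2 cardF two_neq0 Nu BM BM').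
by move=> [s [s_bij /deltaP]]; exists s.
Qed.
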